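(* Suppose $A\in\mathbb{R}^{m\times n}$ is a nonzero matrix. Then $\overline{H}(A)\le\|A\|\cdot H(A)$, and $\overline{H}(A)=H(A)$ when the nonzero columns of $A$ are orthonormal. In particular, $$\overline{H}(A)=\min_{R\in\mathbb{R}^{n\times n}\text{ non-singular}}\|AR\|\cdot H(AR).$$
   Context: Here $m,n\ge 1$; $\mathbb{R}^d$ carries the Euclidean norm $\|\cdot\|$ and matrices carry the induced operator norm $\|M\|=\max_{\|x\|\le 1}\|Mx\|$. $\mathbb{R}^m_+$ is the set of vectors in $\mathbb{R}^m$ with nonnegative entries, $A(\mathbb{R}^n):=\{Ax:x\in\mathbb{R}^n\}$, $\operatorname{dist}(u,T)=\inf_{v\in T}\|u-v\|$, and $(\cdot)_+$ is the componentwise positive part. For a nonzero $A\in\mathbb{R}^{m\times n}$ and $b\in\mathbb{R}^m$ let $P_A(b):=\{x\in\mathbb{R}^n: Ax\le b\}$ (componentwise inequality), which is nonempty if and only if $b\in A(\mathbb{R}^n)+\mathbb{R}^m_+$, and let $AP_A(b):=\{Ax: x\in P_A(b)\}=(b-\mathbb{R}^m_+)\cap A(\mathbb{R}^n)$. Define $$H(A):=\sup\left\{\frac{\operatorname{dist}(x,P_A(b))}{\|(Ax-b)_+\|}: b\in A(\mathbb{R}^n)+\mathbb{R}^m_+,\ x\in\mathbb{R}^n\setminus P_A(b)\right\},$$ $$\overline{H}(A):=\sup\left\{\frac{\operatorname{dist}(y,AP_A(b))}{\|(y-b)_+\|}: b\in A(\mathbb{R}^n)+\mathbb{R}^m_+,\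 y\in A(\mathbb{R}^n)\setminus AP_A(b)\right\},$$ both of which are known to be finite. *)

(* Defs.v *)
From HB Require Import structures.
From mathcomp Require Import all_boot all_order all_algebra.
From mathcomp Require Import all_classical all_reals ereal.

Set Implicit Arguments.
Unset Strict Implicit.
Unset Printing Implicit Defensive.

Import Order.TTheory GRing.Theory Num.Theory.

Local Open Scope classical_set_scope.
Local Open Scope ring_scope.

Definition dot (R : realType) (d : nat) (u v : 'cV[R]_d) : R :=
  \sum_i u i 0 * v i 0.

(* The norm `|u| that MathComp-Analysis puts on matrices is the max norm, so
   the Euclidean norm and its operator norm are defined here. *)
Definition enorm (R : realType) (d : nat) (u : 'cV[R]_d) : R :=
  Num.sqrt (dot u u).

(* The set is nonempty and bounded and its supremum is attained, so this is the
   maximum of |M x| over the closed unit ball. *)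
Definition opnorm (R : realType) (m n : nat) (M : 'M[R]_(m, n)) : R :=
  sup [set enorm (M *m x) | x in [set x : 'cV[R]_n | enorm x <= 1]].

(* [inf set0 = 0]; below, [T] is always nonempty. *)
Definition dist (R : realType) (d : nat) (u : 'cV[R]_d) (T : set 'cV[R]_d) : R :=
  inf [set enorm (u - v) | v in T].

Definition pospart (R : realType) (d : nat) (u : 'cV[R]_d) : 'cV[R]_d :=
  map_mx (fun t => Num.max t 0) u.

Definition nonneg_orthant (R : realType) (d : nat) : set 'cV[R]_d :=
  [set s | forall i, 0 <= s i 0].

Definition range_mx (R : realType) (m n : nat) (A : 'M[R]_(m, n)) :
    set 'cV[R]_m :=
  range (fun x : 'cV[R]_n => A *m x).

Definition feasible_rhs (R : realType) (m n : nat) (A : 'M[R]_(m, n)) :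
    set 'cV[R]_m :=
  [set y + s | y in range_mx A & s in @nonneg_orthant R m].

Definition polyhedron (R : realType) (m n : nat) (A : 'M[R]_(m, n))
    (b : 'cV[R]_m) : set 'cV[R]_n :=
  [set x | forall i, (A *m x) i 0 <= b i 0].

Definition image_polyhedron (R : realType) (m n : nat) (A : 'M[R]_(m, n))
    (b : 'cV[R]_m) : set 'cV[R]_m :=
  [set A *m x | x in polyhedron A b].

(* The suprema are taken in the extended reals, so that they are genuine least
   upper bounds whether or not the set of ratios is known to be bounded ([sup]
   on [R] is 0 on unbounded sets).  The denominators are positive: x lies
   outside the polyhedron, so A x <= b fails (similarly for y). *)
Definition hoffman (R : realType) (m n : nat) (A : 'M[R]_(m, n)) : \bar R :=
  ereal_sup [set r : \bar R | exists (b : 'cV[R]_m) (x : 'cV[R]_n),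
    [/\ feasible_rhs A b, ~ polyhedron A b x &
        r = (dist x (polyhedron A b) / enorm (pospart (A *m x - b)))%:E]].

Definition hoffman_bar (R : realType) (m n : nat) (A : 'M[R]_(m, n)) : \bar R :=
  ereal_sup [set r : \bar R | exists b y : 'cV[R]_m,
    [/\ feasible_rhs A b, range_mx A y, ~ image_polyhedron A b y &
        r = (dist y (image_polyhedron A b) / enorm (pospart (y - b)))%:E]].

(* Orthonormality of the nonzero columns as an indexed family: two equal nonzero
   columns are not orthonormal. *)
Definition nonzero_cols_orthonormal (R : realType) (m n : nat)
    (A : 'M[R]_(m, n)) : Prop :=
  forall j k : 'I_n, col j A != 0 -> col k A != 0 ->
    dot (col j A) (col k A) = (j == k)%:R.

Definition is_min (R : realType) (S : set (\bar R)) (v : \bar R) : Prop :=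
  S v /\ lbound S v.

(* Main.v *)
(* Since A expands norms by a factor of at most |A|, distances to A P_A(b) are at most
   |A| times distances to P_A(b), which gives the inequality. If the nonzero
   columns of A are orthonormal, A is a partial isometry whose kernel is spanned
   by the coordinate vectors of the zero columns, and the two distances agree.
   Finally, the barred constant depends only on the range of A, hence is
   unchanged by A -> A Q for nonsingular Q, and Gram-Schmidt provides a Q for
   which the nonzero columns of A Q are orthonormal; then |A Q| = 1. *)
Require Import Defs.
From mathcomp Require Import all_boot all_order all_algebra.
From mathcomp Require Import all_classical all_reals ereal.

Import Order.TTheory GRing.Theory Num.Theory.

Local Open Scope classical_set_scope.
Local Open Scope ring_scope.

Set Implicit Arguments.
Unset Strict Implicit.
Unset Printing Implicit Defensive.

(** * Euclidean norm and operator norm *)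

Lemma dotE (R : realType) (d : nat) (u v : 'cV[R]_d) :
  dot u v = (u^T *m v) 0 0.
Proof. by rewrite mxE; apply: eq_bigr => i _; rewrite mxE. Qed.

Lemma dot_ge0 (R : realType) (d : nat) (u : 'cV[R]_d) : 0 <= dot u u.
Proof. by apply: sumr_ge0 => i _; rewrite -expr2 sqr_ge0. Qed.

Lemma dotC (R : realType) (d : nat) (u v : 'cV[R]_d) : dot u v = dot v u.
Proof. by apply: eq_bigr => i _; rewrite mulrC. Qed.

Lemma dot0v (R : realType) (d : nat) (v : 'cV[R]_d) : dot 0 v = 0.
Proof. by apply: big1 => i _; rewrite mxE mul0r. Qed.

Lemma dot_eq0 (R : realType) (d : nat) (u : 'cV[R]_d) :
  (dot u u == 0) = (u == 0).
Proof.
apply/eqP/eqP => [u0|->]; last exact: dot0v.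
have ge0 i : true -> 0 <= u i 0 * u i 0 by rewrite -expr2 sqr_ge0.
apply/colP => i; rewrite mxE; apply/eqP.
by have /eqP := @psumr_eq0P _ _ _ _ ge0 u0 i isT; rewrite mulf_eq0 orbb.
Qed.

Lemma dotZ (R : realType) (d : nat) (a b : R) (u v : 'cV[R]_d) :
  dot (a *: u) (b *: v) = a * b * dot u v.
Proof. by rewrite mulr_sumr; apply: eq_bigr => i _; rewrite !mxE mulrACA. Qed.

Lemma dot_col (R : realType) (m n : nat) (A : 'M[R]_(m, n)) (j k : 'I_n) :
  dot (col j A) (col k A) = (A^T *m A) j k.
Proof. by rewrite !mxE; apply: eq_bigr => i _; rewrite !mxE. Qed.

Lemma dot_col_mulmx (R : realType) (m n : nat) (A : 'M[R]_(m, n)) j u :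
  dot (col j A) u = (A^T *m u) j 0.
Proof. by rewrite !mxE; apply: eq_bigr => i _; rewrite !mxE. Qed.

Lemma enorm_ge0 (R : realType) (d : nat) (u : 'cV[R]_d) : 0 <= enorm u.
Proof. exact: sqrtr_ge0. Qed.

Lemma enorm0 (R : realType) (d : nat) : enorm (0 : 'cV[R]_d) = 0.
Proof. by apply/eqP; rewrite sqrtr_eq0 le_eqVlt dot_eq0 eqxx. Qed.

Lemma enorm_eq0 (R : realType) (d : nat) (u : 'cV[R]_d) :
  (enorm u == 0) = (u == 0).
Proof. by rewrite sqrtr_eq0 -dot_eq0 eq_le dot_ge0 andbT. Qed.

Lemma enormZ (R : realType) (d : nat) (a : R) (u : 'cV[R]_d) :
  enorm (a *: u) = `|a| * enorm u.
Proof. by rewrite /enorm dotZ sqrtrM -?expr2 ?sqr_ge0// sqrtr_sqr. Qed.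

Lemma normr_entry_le_enorm (R : realType) (d : nat) (u : 'cV[R]_d) i :
  `|u i 0| <= enorm u.
Proof.
rewrite -sqrtr_sqr ler_wsqrtr// /dot (bigD1 i)//= -expr2 lerDl.
by apply: sumr_ge0 => k _; rewrite -expr2 sqr_ge0.
Qed.

Lemma enorm_le_sum (R : realType) (d : nat) (u : 'cV[R]_d) :
  enorm u <= \sum_i `|u i 0|.
Proof.
have s0 : 0 <= \sum_i `|u i 0| by apply: sumr_ge0.
rewrite -(ger0_norm s0) -sqrtr_sqr ler_wsqrtr// expr2 mulr_suml.
apply: ler_sum => i _; rewrite (le_trans (ler_norm _))// normrM ler_wpM2l//.
by rewrite (bigD1 i)//= lerDl sumr_ge0.
Qed.

(** Rules out the default value 0 of [sup] on unbounded sets. The crude bound by the sum of all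
    [|A i j|] suffices, since each entry of [x] is at most 1 in absolute value. *)
Lemma opnorm_has_ubound (R : realType) (m n : nat) (A : 'M[R]_(m, n)) :
  has_ubound [set enorm (A *m x) | x in [set x : 'cV[R]_n | enorm x <= 1]].
Proof.
exists (\sum_i \sum_j `|A i j|) => _ [x /= x1 <-].
apply: le_trans (enorm_le_sum _) _; apply: ler_sum => i _.
rewrite mxE; apply: le_trans (ler_norm_sum _ _ _) _; apply: ler_sum => j _.
rewrite normrM ler_piMr//; exact: le_trans (normr_entry_le_enorm _ _) x1.
Qed.

Lemma enorm_mulmx_le_opnorm (R : realType) (m n : nat) (A : 'M[R]_(m, n)) x :
  enorm x <= 1 -> enorm (A *m x) <= opnorm A.
Proof.
by move=> x1; apply: (ub_le_sup (opnorm_has_ubound A)); exists x.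
Qed.

Lemma opnorm_ge0 (R : realType) (m n : nat) (A : 'M[R]_(m, n)) : 0 <= opnorm A.
Proof.
apply: le_trans (enorm_ge0 _) (enorm_mulmx_le_opnorm A (x := 0) _).
by rewrite enorm0.
Qed.

Lemma enorm_mulmx_le (R : realType) (m n : nat) (A : 'M[R]_(m, n)) x :
  enorm (A *m x) <= opnorm A * enorm x.
Proof.
have [->|x0] := eqVneq x 0; first by rewrite mulmx0 !enorm0 mulr0.
have ex : 0 < enorm x by rewrite lt_def enorm_eq0 x0 enorm_ge0.
rewrite -ler_pdivrMr// mulrC -[(enorm x)^-1]ger0_norm ?invr_ge0 ?enorm_ge0//.
rewrite -enormZ scalemxAr enorm_mulmx_le_opnorm//.
by rewrite enormZ ger0_norm ?invr_ge0 ?enorm_ge0// mulVf ?gt_eqF.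
Qed.

(** * Distances to polyhedra and to their images *)

Lemma dist_le_enorm (R : realType) (d : nat) (u v : 'cV[R]_d) T :
  T v -> dist u T <= enorm (u - v).
Proof.
move=> Tv; apply: ge_inf; last by exists v.
by exists 0 => _ [w _ <-]; exact: enorm_ge0.
Qed.

Lemma le_dist (R : realType) (d : nat) (u : 'cV[R]_d) T c :
  T !=set0 -> (forall v, T v -> c <= enorm (u - v)) -> c <= dist u T.
Proof.
move=> [v Tv] h; apply: lb_le_inf; first by exists (enorm (u - v)); exists v.
by move=> _ [w Tw <-]; exact: h.
Qed.

Lemma polyhedron_neq0 (R : realType) (m n : nat) (A : 'M[R]_(m, n)) b :
  feasible_rhs A b -> polyhedron A b !=set0.
Proof.
by move=> [_ [x _ <-] [s s0 <-]]; exists x => i; rewrite !mxE lerDl; exact: s0.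
Qed.

Lemma image_polyhedronP (R : realType) (m n : nat) (A : 'M[R]_(m, n)) b x :
  image_polyhedron A b (A *m x) <-> polyhedron A b x.
Proof.
split=> [[z zP Az] i|]; last by exists x.
by rewrite -Az; exact: zP.
Qed.

(** Stated for an arbitrary Lipschitz constant because it serves twice: with [c] equal to
    [opnorm A], and with [c = 1] when the nonzero columns are orthonormal. *)
Lemma hoffman_bar_le (R : realType) (m n : nat) (A : 'M[R]_(m, n)) (c : R) :
  0 <= c -> (forall x, enorm (A *m x) <= c * enorm x) ->
  (hoffman_bar A <= c%:E * hoffman A)%E.
Proof.
(* Writing [y] as [A *m x] keeps the denominator and puts [x] outside the polyhedron, so only the
   two distances remain to be compared. *)
move=> c0 Ac; apply: ge_ereal_sup => _ [b [_ [bP [x _ <-] /image_polyhedronP xP ->]]].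
apply: (@le_trans _ _
  (c%:E * (dist x (polyhedron A b) / enorm (pospart (A *m x - b)))%:E)%E); last first.
  by apply: lee_wpmul2l; rewrite ?lee_fin//; apply: ereal_sup_ubound; exists b, x.
rewrite -EFinM lee_fin mulrA ler_wpM2r ?invr_ge0 ?enorm_ge0//.
have dle v : polyhedron A b v ->
    dist (A *m x) (image_polyhedron A b) <= c * enorm (x - v).
  move=> vP; apply: le_trans (Ac _).
  by rewrite mulmxBr; apply: dist_le_enorm; exists v.
(* Passing to the infimum over [v] requires dividing by [c]. If [c = 0], then [dle] at any feasible
   point already gives the bound 0. *)
move: c0; rewrite le_eqVlt => /predU1P[c0|c0].
  have [v vP] := polyhedron_neq0 bP.
  by have := dle v vP; rewrite -c0 !mul0r.
rewrite -ler_pdivrMl//; apply: le_dist (polyhedron_neq0 bP) _ => v vP.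
by rewrite ler_pdivrMl//; exact: dle.
Qed.

(** * Matrices with orthonormal nonzero columns *)

Lemma nonzero_cols_orthonormalP (R : realType) (m n : nat) (A : 'M[R]_(m, n)) :
  nonzero_cols_orthonormal A <->
  A^T *m A = diag_mx (\row_j (col j A != 0)%:R).
Proof.
split=> [oA|gA j k Aj Ak]; last by rewrite dot_col gA !mxE Aj.
apply/matrixP => j k; rewrite -dot_col !mxE.
have [Aj|Aj] := eqVneq (col j A) 0.
  by rewrite mul0rn Aj dot0v.
have [Ak|Ak] := eqVneq (col k A) 0.
  by rewrite Ak dotC dot0v; case: (eqVneq j k) Aj => // ->; rewrite Ak eqxx.
by rewrite oA.
Qed.

(** The Gram matrix is a 0/1 diagonal matrix, so [A] forgets the coordinates of its zero columns and
    is isometric on the others. *)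
Lemma dot_mulmx_orthonormal (R : realType) (m n : nat) (A : 'M[R]_(m, n)) x :
  nonzero_cols_orthonormal A ->
  dot (A *m x) (A *m x) = \sum_(j | col j A != 0) x j 0 ^+ 2.
Proof.
move=> /nonzero_cols_orthonormalP gA.
rewrite dotE trmx_mul -mulmxA (mulmxA A^T) gA mul_diag_mx mxE [RHS]big_mkcond /=.
apply: eq_bigr => j _; rewrite !mxE.
by case: ifP => _; rewrite ?mul1r ?expr2// mul0r mulr0.
Qed.

Lemma enorm_mulmx_orthonormal_le (R : realType) (m n : nat) (A : 'M[R]_(m, n)) x :
  nonzero_cols_orthonormal A -> enorm (A *m x) <= enorm x.
Proof.
move=> oA; rewrite ler_wsqrtr// dot_mulmx_orthonormal// big_mkcond.
by apply: ler_sum => j _; case: ifP => _; rewrite -expr2 ?sqr_ge0.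
Qed.

Lemma hoffman_bar_orthonormal (R : realType) (m n : nat) (A : 'M[R]_(m, n)) :
  nonzero_cols_orthonormal A -> hoffman_bar A = hoffman A.
Proof.
move=> oA; apply/eqP; rewrite eq_le -[leRHS]mul1e hoffman_bar_le//=; last first.
  by move=> x; rewrite mul1r enorm_mulmx_orthonormal_le.
(* For the converse inequality, the ratio at [x] is compared with the ratio at [A *m x], which has
   the same denominator. *)
apply: ge_ereal_sup => _ [b [x [bP xP ->]]].
apply: (@le_trans _ _ (dist (A *m x) (image_polyhedron A b) /
    enorm (pospart (A *m x - b)))%:E); last first.
  apply: ereal_sup_ubound; exists b, (A *m x); split => //; first by exists x.
  by move/image_polyhedronP.
rewrite lee_fin ler_wpM2r ?invr_ge0 ?enorm_ge0//.
apply: le_dist.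
  by have [v vP] := polyhedron_neq0 bP; exists (A *m v); exists v.
move=> _ [v vP <-].
(* Moving [v] along the kernel of [A] to match [x] on the zero columns makes
   [A] isometric on [x - w]. *)
pose w : 'cV[R]_n := \col_j (if col j A != 0 then v j 0 else x j 0).
have Aw : A *m w = A *m v.
  apply/matrixP => i k; rewrite !mxE; apply: eq_bigr => j _.
  rewrite !mxE ord1; case: ifPn => //; rewrite negbK => /eqP/colP/(_ i).
  by rewrite !mxE => ->; rewrite !mul0r.
have wP : polyhedron A b w by apply/image_polyhedronP; exists v.
apply: le_trans (dist_le_enorm x wP) _.
rewrite -Aw -mulmxBr ler_wsqrtr// dot_mulmx_orthonormal// [leRHS]big_mkcond.
apply: ler_sum => j _; rewrite !mxE -expr2.
by case: ifP => //; rewrite subrr expr0n.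
Qed.

(** [A] does not expand norms, and the value 1 is attained at the basis vector of a nonzero column,
    which exists because [A] is nonzero. *)
Lemma opnorm_orthonormal (R : realType) (m n : nat) (A : 'M[R]_(m, n)) :
  A != 0 -> nonzero_cols_orthonormal A -> opnorm A = 1.
Proof.
move=> A0 oA; apply/eqP; rewrite eq_le; apply/andP; split.
  apply: ge_sup; first by exists (enorm (A *m 0)); exists 0 => //=; rewrite enorm0.
  by move=> _ [x x1 <-]; exact: le_trans (enorm_mulmx_orthonormal_le _ oA) x1.
have [j Aj] : exists j, col j A != 0.
  apply/existsP; rewrite -negb_forall; apply: contra A0 => /forallP A0.
  apply/eqP/matrixP => i j; have /eqP/colP/(_ i) := A0 j.
  by rewrite !mxE.
have -> : 1 = enorm (A *m delta_mx j 0) by rewrite -colE /enorm oA// eqxx sqrtr1.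
apply: enorm_mulmx_le_opnorm.
rewrite /enorm /dot (bigD1 j)//= big1 => [|k kj]; rewrite !mxE ?eqxx.
  by rewrite mulr1 addr0 sqrtr1.
by rewrite (negbTE kj) mul0r.
Qed.

(* Gram-Schmidt, adding one column on the left. *)
Lemma ex_unitmx_orthonormal (R : realType) (m n : nat) (A : 'M[R]_(m, n)) :
  exists2 Q : 'M[R]_n, Q \in unitmx & nonzero_cols_orthonormal (A *m Q).
Proof.
elim: n A => [|n IHn]; first by exists 1%:M; [exact: unitmx1|case].
rewrite -[n.+1]/(1 + n)%N => A.
have [Q Qu oB] := IHn (rsubmx A); set a := lsubmx A.
set B := rsubmx A *m Q in oB.
(* [B *m B^T] is the orthogonal projection onto the range of [B], so [a'] is the component of [a]
   orthogonal to all columns of [B]. *)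
pose a' := a - B *m (B^T *m a).
have BTa' : B^T *m a' = 0.
  rewrite mulmxBr (mulmxA B^T) ((nonzero_cols_orthonormalP _).1 oB) mul_diag_mx.
  apply/eqP; rewrite subr_eq0; apply/eqP/matrixP => j k; rewrite !mxE.
  (* At a zero column of [B] the Gram matrix has a 0 on the diagonal, but the entry of [B^T *m a]
     vanishes there too. *)
  case: eqP => [/colP Bj|_]; rewrite ?mul1r// mul0r big1// => i _.
  by rewrite mxE; have := Bj i; rewrite !mxE => ->; rewrite mul0r.
(* When [a] lies in the range of [B] the new column is 0 and cannot be normalized; the factor 1 then
   keeps the change of basis nonsingular. *)
pose c := if a' == 0 then 1 else (enorm a')^-1.
have c0 : c != 0.
  by rewrite /c; case: (eqVneq a' 0) => [_|]; rewrite ?oner_eq0// invr_eq0 enorm_eq0.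
(* The first block column turns [A] into [c *: a']. The matrix is block triangular with determinant
   [c] times that of [Q]. *)
exists (block_mx c%:M 0 (- c *: (Q *m (B^T *m a))) Q).
  rewrite unitmxE det_lblock unitrM -[in X in _ && X]unitmxE Qu andbT.
  by rewrite det_scalar unitfE expf_eq0/=.
have -> : A *m (block_mx c%:M 0 (- c *: (Q *m (B^T *m a))) Q) =
    row_mx (c *: a') B.
  rewrite -[A in LHS]hsubmxK mul_row_block mulmx0 add0r; congr row_mx.
  by rewrite mul_mx_scalar -scalemxAr (mulmxA (rsubmx A)) scaleNr -scalerBr.
have dotBa' j : dot (col j B) (c *: a') = 0.
  by rewrite dot_col_mulmx -scalemxAr BTa' scaler0 mxE.
move=> j k; case: (split_ordP j) => {}j ->; case: (split_ordP k) => {}k ->.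
- rewrite !colKl !ord1 !col_id eqxx scaler_eq0 (negbTE c0)/= => a0 _.
  rewrite dotZ /c (negbTE a0) -expr2 exprVn sqr_sqrtr ?dot_ge0//.
  by rewrite mulVf// dot_eq0.
- by rewrite colKl colKr ord1 col_id dotC dotBa' eq_lrshift.
- by rewrite colKl colKr ord1 col_id dotBa' eq_rlshift.
- by rewrite !colKr eq_rshift; exact: oB.
Qed.

(** * Invariance under nonsingular changes of variable *)

Lemma range_mulmx_unit (R : realType) (m n : nat) (A : 'M[R]_(m, n)) Q :
  Q \in unitmx -> range_mx (A *m Q) = range_mx A.
Proof.
move=> Qu; apply/seteqP; split=> _ [x _ <-].
  by exists (Q *m x) => //; rewrite mulmxA.
by exists (invmx Q *m x) => //; rewrite mulmxA mulmxK.
Qed.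

Lemma image_polyhedron_mulmx_unit (R : realType) (m n : nat) (A : 'M[R]_(m, n))
    Q b : Q \in unitmx -> image_polyhedron (A *m Q) b = image_polyhedron A b.
Proof.
move=> Qu; apply/seteqP; split=> _ [x xP <-].
  by exists (Q *m x); [move=> i; rewrite mulmxA; exact: xP|rewrite mulmxA].
have AQ : A *m Q *m (invmx Q *m x) = A *m x by rewrite mulmxA mulmxK.
by exists (invmx Q *m x) => // i; rewrite AQ; exact: xP.
Qed.

Lemma hoffman_bar_mulmx_unit (R : realType) (m n : nat) (A : 'M[R]_(m, n)) Q :
  Q \in unitmx -> hoffman_bar (A *m Q) = hoffman_bar A.
Proof.
move=> Qu; rewrite /hoffman_bar /feasible_rhs range_mulmx_unit//.
by under eq_fun do under eq_exists do under eq_exists do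
  rewrite image_polyhedron_mulmx_unit//.
Qed.

Theorem proposition3 (R : realType) (m n : nat) (m_gt0 : (0 < m)%N)
    (n_gt0 : (0 < n)%N) (A : 'M[R]_(m, n)) (A_neq0 : A != 0) :
  [/\ (hoffman_bar A <= (opnorm A)%:E * hoffman A)%E,
      nonzero_cols_orthonormal A -> hoffman_bar A = hoffman A &
      is_min [set ((opnorm (A *m Q))%:E * hoffman (A *m Q))%E
               | Q in [set Q : 'M[R]_n | Q \in unitmx]]
             (hoffman_bar A)].
Proof.
have le_opnorm B : (hoffman_bar B <= (opnorm B)%:E * @hoffman R m n B)%E.
  by apply: hoffman_bar_le; [exact: opnorm_ge0|exact: enorm_mulmx_le].
split; [exact: le_opnorm|exact: hoffman_bar_orthonormal|split].
  (* The minimum is attained at the Gram-Schmidt matrix: the operator norm of [A *m Q] is 1, as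
     [A *m Q] is nonzero, and its two constants coincide. *)
  have [Q Qu oAQ] := ex_unitmx_orthonormal A; exists Q => //.
  have AQ0 : A *m Q != 0.
    by apply: contra A_neq0 => /eqP AQ0; rewrite -(mulmxK Qu A) AQ0 mul0mx.
  rewrite opnorm_orthonormal// mul1e -hoffman_bar_orthonormal//.
  exact: hoffman_bar_mulmx_unit.
(* Every other [Q] gives at least this value, by [le_opnorm] applied to [A *m Q]. *)
by move=> _ [Q Qu <-]; rewrite -(hoffman_bar_mulmx_unit A Qu).
Qed.
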